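(* Let $n$ be a positive even integer and let $X_1,\ldots,X_n$ be independent discrete random vectors in $\mathbb{R}^d$ (not necessarily identically distributed). Then there is $j\in\{1,2,\ldots,n\}$ such that for all $x\in\mathbb{R}^d$ $$\mathbb{P}(X_1+\cdots+X_n=x)\le \mathbb{P}(Y_1-Y_2+\cdots+Y_{n-1}-Y_n=0),$$ where $Y_1,\dots,Y_n$ are independent identically distributed copies of $X_j$. The inequality is strict unless $\sum_{i=1}^n X_i-x$ and $\sum_{i=1}^n(-1)^{i+1}Y_i$ have the same distribution.
   Context: A random vector is discrete if it takes values in a countable set almost surely. *)

(* Defs.v *)
From HB Require Import structures.
From mathcomp Require Import all_boot all_order all_algebra.
From mathcomp Require Import all_classical all_reals all_analysis.

Set Implicit Arguments.
Unset Strict Implicit.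
Unset Printing Implicit Defensive.

Import Order.TTheory GRing.Theory Num.Theory.
Import numFieldNormedType.Exports.

Local Open Scope classical_set_scope.
Local Open Scope ring_scope.

(* The library provides no sigma-algebra on matrices.  R^d is 'rV[R]_d with the
   sigma-algebra generated by the open sets of the (product) topology. *)
Section borel_rV.
Context (R : realType) (d : nat).

Let borel : set (set 'rV[R]_d) := <<s @open 'rV[R]_d >>.

Let borel0 : borel set0.
Proof. exact: sigma_algebra0. Qed.

Let borelC (A : set 'rV[R]_d) : borel A -> borel (~` A).
Proof. exact: sigma_algebraC. Qed.

Let borel_bigcup (F : (set 'rV[R]_d)^nat) :
  (forall i, borel (F i)) -> borel (\bigcup_i F i).
Proof. exact: sigma_algebra_bigcup. Qed.

HB.instance Definition _ :=
  @isMeasurable.Build (sigma_display (@open 'rV[R]_d)) 'rV[R]_d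
    borel borel0 borelC borel_bigcup.

End borel_rV.

Section random_elements.
Context (R : realType) (dT dE : measure_display).
Context (T : measurableType dT) (E : measurableType dE) (P : probability T R).

Definition discrete_rv (X : {RV P >-> E}) : Prop :=
  exists2 C : set E, countable C & {ae P, forall w, C (X w)}.

Definition mutually_independent (I : finType) (X : I -> {RV P >-> E}) : Prop :=
  forall (J : {set I}) (B : I -> set E),
    (forall i, measurable (B i)) ->
    P (\bigcap_(i in [set` J]) X i @^-1` B i) =
      (\prod_(i in J) P (X i @^-1` B i))%E.

End random_elements.

(* The two maps may live on different probability spaces; they are not bundled
   as random variables so that sums can be used directly. *)
Definition same_distribution (R : realType) (d1 d2 dE : measure_display)
    (T1 : measurableType d1) (T2 : measurableType d2) (E : measurableType dE)
    (P1 : probability T1 R) (P2 : probability T2 R)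
    (X : T1 -> E) (Y : T2 -> E) : Prop :=
  forall A : set E, measurable A -> pushforward P1 X A = pushforward P2 Y A.

Definition iid_copies (R : realType) (d1 d2 dE : measure_display)
    (T1 : measurableType d1) (T2 : measurableType d2) (E : measurableType dE)
    (P1 : probability T1 R) (P2 : probability T2 R) (I : finType)
    (Y : I -> {RV P2 >-> E}) (X : {RV P1 >-> E}) : Prop :=
  mutually_independent Y /\ forall i, same_distribution P2 P1 (Y i) X.

(* With indices starting at 0, the i-th term of Y_1 - Y_2 + ... carries the
   sign (-1)^i. *)
Definition alternating_sum (R : realType) (d n : nat) (T : Type)
    (Y : 'I_n -> T -> 'rV[R]_d) (w : T) : 'rV[R]_d :=
  \sum_(i < n) (-1) ^+ i *: Y i w.

(* Main.v *)
Require Import Defs.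
(* Write f~(x) = f(-x).  Convolving probability mass functions, AM-GM gives
     (f * g)(0) <= ((f * f~)(0) + (g * g~)(0)) / 2,
   with equality iff g = f~.  Among all words i_1 ... i_m, with n = 2m, let one
   maximize N = (q_{i_1} * ... * q_{i_m})(0), where q_i = p_i * p_i~ and p_i is
   the law of X_i.  By AM-GM, replacing a letter of a maximal word by another of
   its letters changes neither N nor the whole law q_{i_1} * ... * q_{i_m}, so
   j can be any letter of a maximal word.  Finally AM-GM for the two halves
   X_1 + ... + X_m and X_{m+1} + ... + X_n bounds P(S = x) by the maximum of N,
   and equality forces both halves to be maximal words with
   law(S - x) = q_j^{*m}. *)
From HB Require Import structures.
From mathcomp Require Import all_boot all_order all_algebra.
From mathcomp Require Import ring lra.
From mathcomp Require Import all_classical all_reals all_analysis.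

Set Implicit Arguments.
Unset Strict Implicit.
Unset Printing Implicit Defensive.

Import Order.TTheory GRing.Theory Num.Theory.
Import numFieldNormedType.Exports.

Local Open Scope classical_set_scope.
Local Open Scope ring_scope.

(** * Sums of extended reals over arbitrary index types *)

Section esum_complements.
Context (R : realType) (T : choiceType).
Local Open Scope ereal_scope.

Lemma exchange_esum (T' : choiceType) (a : T -> T' -> \bar R) :
  (forall i j, 0 <= a i j) ->
  \esum_(i in setT) \esum_(j in setT) a i j =
  \esum_(j in setT) \esum_(i in setT) a i j.
Proof.
move=> a_ge0.
rewrite (esum_esum (fun _ _ _ _ => a_ge0 _ _)).
rewrite (esum_esum (fun _ _ _ _ => a_ge0 _ _)).
rewrite (reindex_esum (setT `*` setT) _ (fun x => (x.2, x.1)))//; split => //=.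
  by move=> [i1 i2] [j1 j2] /= _ _ [] -> ->.
by move=> [i1 i2] _; exists (i2, i1).
Qed.

Lemma reindex_esumT (e : T -> T) (a : T -> \bar R) :
  bijective e -> \esum_(i in setT) a i = \esum_(i in setT) a (e i).
Proof. by move=> e_bij; apply: reindex_esum; rewrite setTT_bijective. Qed.

Lemma esum_delta (i0 : T) (a : T -> \bar R) :
  0 <= a i0 -> (forall i, i != i0 -> a i = 0) ->
  \esum_(i in setT) a i = a i0.
Proof.
move=> a_ge0 a0; rewrite -[RHS](esum_set1 (a_ge0)) [RHS]esum_mkcond.
apply: eq_esum => i _; case: ifPn => // /negP; rewrite inE/= => ii0.
by rewrite a0//; apply/eqP.
Qed.

(** Distributing [c] over finite partial sums gives [<=]; for nonzero [c], the same inequality with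
    the factor [c^-1] gives the converse. *)
Lemma esumZl (c : \bar R) (a : T -> \bar R) :
  0 <= c -> c \is a fin_num -> (forall i, 0 <= a i) ->
  \esum_(i in setT) (c * a i) = c * \esum_(i in setT) a i.
Proof.
move=> c_ge0 c_fin a_ge0.
have Mle (b : T -> \bar R) (r : \bar R) : 0 <= r -> r \is a fin_num ->
    (forall i, 0 <= b i) ->
    \esum_(i in setT) (r * b i) <= r * \esum_(i in setT) b i.
  move=> r_ge0 r_fin b_ge0; apply: ge_ereal_sup => _ [X [Xfin _]] <-.
  rewrite fsbig_finite//= -ge0_sume_distrr//.
  apply: lee_wpmul2l => //; rewrite -fsbig_finite//.
  by apply: esum_ge; exists X.
apply/eqP; rewrite eq_le Mle//=.
have [->|c_neq0] := eqVneq c 0.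
  by rewrite mul0e esum_ge0// => i _; rewrite mul0e.
case: c c_ge0 c_fin c_neq0 => // r r_ge0 _ r_neq0.
have r_gt0 : (0 < r)%R by rewrite lt_neqAle eq_sym -eqe r_neq0/= -lee_fin.
rewrite muleC -lee_pdivlMr// muleC.
have -> : \esum_(i in setT) a i = \esum_(i in setT) (r^-1%:E * (r%:E * a i)).
  apply: eq_esum => i _.
  by rewrite muleA -EFinM mulVf ?mul1e// gt_eqF.
by apply: Mle => // [|i]; rewrite ?mule_ge0// lee_fin invr_ge0 ltW.
Qed.

End esum_complements.

(** * Probability mass functions on an abelian group under convolution *)

Section pmf.
Context (R : realType) (G : zmodType).
Local Open Scope ereal_scope.

Record pmf := Pmf {
  pmf_fun :> G -> \bar R;
  pmf_ge0 : forall x, 0 <= pmf_fun x;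
  pmf_sum1 : \esum_(x in setT) pmf_fun x = 1 }.

(** Turns pointwise equality of laws into Leibniz equality, so that convolution can be a commutative
    monoid law for big operators and [AC] rewriting. *)
Lemma pmf_ext (f g : pmf) : f =1 g -> f = g.
Proof.
case: f g => [f f0 f1] [g g0 g1] /= /funext fg.
rewrite fg in f0 f1 *; congr Pmf; exact: Prop_irrelevance.
Qed.

Lemma pmf_le1 (f : pmf) x : f x <= 1.
Proof.
rewrite -(pmf_sum1 f); apply: esum_ge; exists [set x] => //.
by rewrite fsbig_set1.
Qed.

Lemma pmf_fin_num (f : pmf) x : f x \is a fin_num.
Proof.
rewrite ge0_fin_numE ?pmf_ge0//.
by rewrite (le_lt_trans (pmf_le1 f x))// ltry.
Qed.

Definition dirac_fun (a x : G) : \bar R := (x == a)%:R%:E.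

Lemma dirac_fun_ge0 a x : 0 <= dirac_fun a x.
Proof. by rewrite lee_fin ler0n. Qed.

Lemma dirac_fun_sum1 a : \esum_(x in setT) dirac_fun a x = 1.
Proof.
rewrite (@esum_delta _ _ a) ?dirac_fun_ge0 /dirac_fun ?eqxx//.
by move=> i /negPf ->.
Qed.

Definition dirac_pmf a := Pmf (dirac_fun_ge0 a) (dirac_fun_sum1 a).

Definition conv_fun (f g : pmf) (x : G) : \bar R :=
  \esum_(y in setT) (f y * g (x - y)%R).

Lemma conv_fun_ge0 f g x : 0 <= conv_fun f g x.
Proof. by apply: esum_ge0 => y _; rewrite mule_ge0 ?pmf_ge0. Qed.

Lemma conv_fun_sum1 f g : \esum_(x in setT) conv_fun f g x = 1.
Proof.
rewrite exchange_esum => [|x y]; last by rewrite mule_ge0 ?pmf_ge0.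
rewrite -[RHS](pmf_sum1 f); apply: eq_esum => y _.
rewrite esumZl ?pmf_ge0 ?pmf_fin_num// => [|x]; last exact: pmf_ge0.
rewrite -(@reindex_esumT _ _ (fun x => x - y)%R g) ?pmf_sum1 ?mule1//.
by exists (fun x => x + y)%R => x; rewrite ?subrK ?addrK.
Qed.

Definition conv f g := Pmf (conv_fun_ge0 f g) (conv_fun_sum1 f g).

Lemma convE f g x : conv f g x = \esum_(y in setT) (f y * g (x - y)%R).
Proof. by []. Qed.

Lemma convC : commutative conv.
Proof.
move=> f g; apply: pmf_ext => x; rewrite !convE.
rewrite (@reindex_esumT _ _ (fun y => x - y)%R); last first.
  by exists (fun y => x - y)%R => y; rewrite subKr.
by apply: eq_esum => y _; rewrite subKr muleC.
Qed.

Lemma convA : associative conv.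
Proof.
move=> f g h; apply: pmf_ext => x; rewrite !convE.
(* [z] is the sum of the first two variables, so the sum over the second one is translated by
   [y]. *)
transitivity (\esum_(y in setT) \esum_(z in setT)
    (f y * g (z - y)%R * h (x - z)%R)).
  apply: eq_esum => y _; rewrite convE.
  rewrite -esumZl ?pmf_ge0 ?pmf_fin_num//; last first.
    by move=> z; rewrite mule_ge0 ?pmf_ge0.
  rewrite [RHS](@reindex_esumT _ _ (fun z => z + y)%R); last first.
    by exists (fun z => z - y)%R => z; rewrite ?subrK ?addrK.
  by apply: eq_esum => z _; rewrite addrK opprD addrCA addrC muleA.
rewrite exchange_esum; last by move=> y z; rewrite !mule_ge0 ?pmf_ge0.
apply: eq_esum => z _; rewrite convE muleC.
rewrite -esumZl ?pmf_ge0 ?pmf_fin_num//; last first.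
  by move=> y; rewrite mule_ge0 ?pmf_ge0.
by apply: eq_esum => y _; rewrite muleC.
Qed.

Lemma conv_diracE f a x : conv f (dirac_pmf a) x = f (x - a)%R.
Proof.
rewrite convE (@esum_delta _ _ (x - a)%R) /= /dirac_fun.
- by rewrite subKr eqxx mule1.
- by rewrite subKr eqxx mule1 pmf_ge0.
- by move=> y; rewrite eq_sym !subr_eq addrC => /negPf ->; rewrite mule0.
Qed.

Lemma conv1f : left_id (dirac_pmf 0%R) conv.
Proof. by move=> f; apply: pmf_ext => x; rewrite convC conv_diracE subr0. Qed.

HB.instance Definition _ :=
  Monoid.isComLaw.Build pmf (dirac_pmf 0%R) conv convA convC conv1f.

Lemma mirror_fun_sum1 (f : pmf) : \esum_(x in setT) f (- x)%R = 1.
Proof.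
rewrite -[RHS](pmf_sum1 f) -(@reindex_esumT _ _ -%R)//.
Qed.

Definition mirror (f : pmf) :=
  Pmf (fun x => pmf_ge0 f (- x)%R) (mirror_fun_sum1 f).

Lemma mirrorE f x : mirror f x = f (- x)%R. Proof. by []. Qed.

Lemma mirrorK : involutive mirror.
Proof. by move=> f; apply: pmf_ext => x; rewrite !mirrorE opprK. Qed.

Lemma mirror_conv : {morph mirror : f g / conv f g}.
Proof.
move=> f g; apply: pmf_ext => x; rewrite mirrorE !convE.
rewrite (@reindex_esumT _ _ -%R); last by exists -%R => y; rewrite opprK.
by apply: eq_esum => y _; rewrite !mirrorE opprB opprK addrC.
Qed.

Lemma mirror_dirac a : mirror (dirac_pmf a) = dirac_pmf (- a)%R.
Proof.
apply: pmf_ext => x; rewrite mirrorE /= /dirac_fun.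
by rewrite eqr_oppLR.
Qed.

Lemma conv_dirac a b : conv (dirac_pmf a) (dirac_pmf b) = dirac_pmf (a + b)%R.
Proof.
apply: pmf_ext => x; rewrite conv_diracE /= /dirac_fun.
by rewrite subr_eq.
Qed.

(** The law of [U - U'] for independent [U] and [U'] of law [f]; its value at 0 is the squared l2
    norm of [f]. *)
Definition symm f := conv f (mirror f).

Lemma symm_mirror f : symm (mirror f) = symm f.
Proof. by rewrite /symm mirrorK convC. Qed.

Lemma symm_conv : {morph symm : f g / conv f g}.
Proof. by move=> f g; rewrite /symm mirror_conv [LHS]Monoid.mulmACA. Qed.

Lemma symm_dirac a : symm (dirac_pmf a) = dirac_pmf 0%R.
Proof. by rewrite /symm mirror_dirac conv_dirac subrr. Qed.

Lemma symm0E f : symm f 0%R = \esum_(x in setT) (f x * f x).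
Proof.
by rewrite convE; apply: eq_esum => y _; rewrite mirrorE sub0r opprK.
Qed.

(* AM-GM: [2 u v + (u - v)^2 = u^2 + v^2], summed. *)
Lemma conv_le_symm f g (M : \bar R) : M \is a fin_num ->
  symm f 0%R <= M -> symm g 0%R <= M ->
  conv f g 0%R <= M /\ (conv f g 0%R = M -> g = mirror f).
Proof.
move=> M_fin; rewrite -(symm_mirror g); set h := mirror g => FM HM.
(* Since [g = mirror h], the convolution at 0 is the inner product of [f] and [h]. *)
have -> : conv f g 0%R = \esum_(x in setT) (f x * h x).
  by rewrite convE; apply: eq_esum => y _; rewrite /h mirrorE sub0r.
pose D x : \bar R := (f x - h x) * (f x - h x).
have D_ge0 x : 0 <= D x.
  rewrite /D; case: (f x) (pmf_fin_num f x) (h x) (pmf_fin_num h x) => // r _.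
  by case=> // s _; rewrite -EFinB -EFinM lee_fin -expr2 sqr_ge0.
have : \esum_(x in setT) (f x * h x) + \esum_(x in setT) (f x * h x) +
    \esum_(x in setT) D x = symm f 0%R + symm h 0%R.
  have fg_ge0 (p q : pmf) x : 0 <= p x * q x by rewrite mule_ge0 ?pmf_ge0.
  rewrite !symm0E -!esumD//; last by move=> x _; rewrite adde_ge0.
  apply: eq_esum => x _; rewrite /D.
  case: (f x) (pmf_fin_num f x) (h x) (pmf_fin_num h x) => // r _.
  by case=> // s _; rewrite -EFinB -!EFinM -!EFinD; congr EFin; ring.
have : 0 <= \esum_(x in setT) (f x * h x).
  by apply: esum_ge0 => x _; rewrite mule_ge0 ?pmf_ge0.
have : 0 <= \esum_(x in setT) D x by exact: esum_ge0.
have D_le x : D x <= \esum_(x in setT) D x.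
  by apply: esum_ge; exists [set x]; rewrite ?fsbig_set1.
move: FM HM D_le.
case: M M_fin => // m _.
case: (symm f 0%R) (pmf_fin_num (symm f) 0%R) => // F _.
case: (symm h 0%R) (pmf_fin_num (symm h) 0%R) => // H _.
case: (esum _ _) => [SD| |]//; case: (esum _ _) => [S| |]//.
rewrite -!EFinD !lee_fin => FM HM D_le SD0 S0 [E]; split; first by lra.
case=> Sm; rewrite -[g]mirrorK; congr mirror; apply/esym/pmf_ext => x.
(* [2 S + SD = F + H <= 2 m] with [S = m] leaves [SD = 0], and each square [D x] lies between 0 and
   [SD]. *)
have := D_le x; have {D_le SD0}-> : SD = 0%R by lra.
have := D_ge0 x; rewrite /D -/h.
case: (f x) (pmf_fin_num f x) (h x) (pmf_fin_num h x) => // r _.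
case=> // s _; rewrite -EFinB -EFinM !lee_fin -expr2 => D0 D0'; congr EFin.
by apply/eqP; rewrite -subr_eq0 -sqrf_eq0 eq_le D0' D0.
Qed.

End pmf.

(** * Words in the laws [p i] and the maximal ones among them *)

Section convolution_powers.
Context (R : realType) (G : zmodType) (I : finType) (p : I -> pmf R G).
Local Open Scope ereal_scope.
Local Notation "f \* g" := (conv f g) (at level 40, left associativity).

(** A letter occurring twice in the word stands for two independent copies. *)
Definition conv_seq (s : seq I) : pmf R G :=
  \big[@conv R G/dirac_pmf R 0%R]_(i <- s) p i.

Lemma conv_seq_cons i s : conv_seq (i :: s) = p i \* conv_seq s.
Proof. by rewrite /conv_seq big_cons. Qed.

Lemma conv_seq_cat s t : conv_seq (s ++ t) = conv_seq s \* conv_seq t.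
Proof. by rewrite /conv_seq big_cat. Qed.

Lemma perm_conv_seq s t : perm_eq s t -> conv_seq s = conv_seq t.
Proof. by move=> st; apply: perm_big. Qed.

Section maximal.
Variables (m : nat) (M : \bar R).
Hypothesis M_fin : M \is a fin_num.
Hypothesis M_max : forall s, size s = m -> symm (conv_seq s) 0%R <= M.

(* The product defining [symm (a^(k+1) b r)] is split as [f \* g] so that [b]
   is traded for another copy of [a] in [symm f] and conversely in [symm g]. *)
Lemma symm_swap k a b r : size (nseq k.+1 a ++ b :: r) = m ->
  symm (conv_seq (nseq k.+1 a ++ b :: r)) 0%R = M ->
  symm (conv_seq (nseq k.+2 a ++ r)) = symm (conv_seq (nseq k.+1 a ++ b :: r)).
Proof.
move=> szm sM; pose P := conv_seq (nseq k a); pose Q := conv_seq r.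
pose f := P \* p a \* mirror (p a) \* Q.
pose g := mirror P \* p b \* mirror (p b) \* mirror Q.
have symm_f : symm f = symm (conv_seq (nseq k.+2 a ++ r)).
  rewrite conv_seq_cat !conv_seq_cons -/P -/Q /f !symm_conv symm_mirror.
  by rewrite [RHS](AC ((1*2)*1) (3*2*1*4))%AC.
have symm_g : symm g = symm (conv_seq (nseq k a ++ [:: b, b & r])).
  rewrite conv_seq_cat !conv_seq_cons -/P -/Q /g !symm_conv !symm_mirror.
  by rewrite !convA.
have fg : f \* g = symm (conv_seq (nseq k.+1 a ++ b :: r)).
  rewrite conv_seq_cat !conv_seq_cons -/P -/Q /f /g /symm !mirror_conv.
  by rewrite [LHS](AC (4*4) ((2*1*(6*4))*(3*5*(7*8))))%AC.
have [] := @conv_le_symm _ _ f g M M_fin.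
- rewrite symm_f; apply: M_max; rewrite -szm !size_cat !size_nseq /=.
  by rewrite addnS.
- rewrite symm_g; apply: M_max; rewrite -szm !size_cat !size_nseq /=.
  by rewrite addnS.
by rewrite fg => _ /(_ sM) gf; rewrite -symm_f -fg gf.
Qed.

(** [symm_swap] turns the remaining letters into [a] one by one; the symmetrized law is unchanged
    each time, so the new word is still maximal and the induction goes on. *)
Lemma symm_maximal_nseq a s : size s = m -> symm (conv_seq s) 0%R = M ->
  a \in s -> symm (conv_seq s) = symm (conv_seq (nseq m a)).
Proof.
move=> szm sM /perm_to_rem s_perm.
have {}s_perm : perm_eq s (nseq 1 a ++ rem a s) by [].
move: szm sM; rewrite (perm_size s_perm) (perm_conv_seq s_perm).
(* A single [a] in front is the case [k = 0] of the prefix [nseq k.+1 a], over which the induction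
   generalizes. *)
move: (rem a s) 0%N => r; elim: r => [|b r IH] k szm sM.
  by rewrite -szm cats0 size_nseq.
have E := symm_swap szm sM; rewrite -E IH//; last by rewrite E.
by rewrite -szm !size_cat !size_nseq/= addnS.
Qed.

End maximal.

(** The words [s] and [t] are to spell the two halves of the sum. Equality makes both of them
    maximal, and whichever contains [j] then has the symmetrized law of [nseq m j]. *)
Lemma exists_maximal_power (m : nat) (i0 : I) : (0 < m)%N ->
  exists j, forall (s t : seq I) x, size s = m -> size t = m ->
    j \in s ++ t ->
    (conv_seq s \* conv_seq t) x <= symm (conv_seq (nseq m j)) 0%R /\
    ((conv_seq s \* conv_seq t) x = symm (conv_seq (nseq m j)) 0%R ->
     conv_seq s \* conv_seq t \* dirac_pmf R (- x)%R =
     symm (conv_seq (nseq m j))).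
Proof.
move=> m_gt0; pose F (s : m.-tuple I) := symm (conv_seq s) 0%R.
have [s0 _ s0_max] := @arg_maxP _ _ _ (nseq_tuple m i0) xpredT F isT.
have M_max s : size s = m -> symm (conv_seq s) 0%R <= F s0.
  by move=> /eqP szm; exact: (s0_max (Tuple szm)).
have M_fin : F s0 \is a fin_num := pmf_fin_num _ _.
(* As [0 < m], the maximal word is nonempty: [j] is its first letter and [head] never falls back on
   the default [i0]. *)
pose j := head i0 s0; exists j => s t x szs szt jst.
have js0 : j \in tval s0.
  by rewrite /j -nth0 mem_nth// size_tuple.
rewrite -(symm_maximal_nseq M_fin M_max (size_tuple _) erefl js0) -/(F s0).
(* The shift by [-x] joins the second half: evaluation moves from [x] to 0, while [symm] does not
   see the shift. *)
set g := conv_seq t \* dirac_pmf R (- x)%R.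
have -> : (conv_seq s \* conv_seq t) x = (conv_seq s \* g) 0%R.
  by rewrite /g convA conv_diracE opprK add0r.
have symm_g : symm g = symm (conv_seq t).
  by rewrite symm_conv symm_dirac Monoid.mulm1.
have [||le_max eq_max] := @conv_le_symm _ _ (conv_seq s) g (F s0) M_fin.
- exact: M_max.
- by rewrite symm_g; apply: M_max.
split=> // /[dup] sg_max /eq_max gE; rewrite -convA -/g.
rewrite (symm_maximal_nseq M_fin M_max (size_tuple _) erefl js0).
have sgE : conv_seq s \* g = symm (conv_seq s) by rewrite gE.
have stE : symm (conv_seq s) = symm (conv_seq t).
  by rewrite -symm_g gE symm_mirror.
rewrite sgE in sg_max *; move: jst; rewrite mem_cat => /orP[js|jt].
  exact: (symm_maximal_nseq M_fin M_max).
by rewrite stE in sg_max *; exact: (symm_maximal_nseq M_fin M_max).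
Qed.

End convolution_powers.

(** * Countable additivity, laws of discrete maps and of independent sums *)

Section countable_additivity.
Context (R : realType) (dT : measure_display) (T : measurableType dT).
Context (P : probability T R).
Local Open Scope ereal_scope.

Lemma measure_countable_bigcup (I : choiceType) (C : set I) (F : I -> set T) :
  countable C -> (forall i, C i -> measurable (F i)) -> trivIset C F ->
  P (\bigcup_(i in C) F i) = \esum_(i in C) P (F i).
Proof.
move=> /countable_injP[f f_inj] mF tF.
(* [B n] is the [F i] whose code [f i] is [n], which gives a family indexed by naturals, ready for
   sigma-additivity. *)
pose B n := \bigcup_(i in C `&` f @^-1` [set n]) F i.
have BfE i : C i -> B (f i) = F i.
  move=> Ci; rewrite /B -[RHS](bigcup_set1 F i); congr bigcup.
  apply/seteqP; split=> [k [Ck fk]|_ ->]//=.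
  by apply: f_inj; rewrite ?inE.
have mB n : (f @` C) n -> measurable (B n).
  by move=> [i Ci <-]; rewrite BfE//; exact: mF.
have tB : trivIset (f @` C) B.
  move=> _ _ [i Ci <-] [k Ck <-]; rewrite !BfE// => FiFk.
  by rewrite (tF _ _ Ci Ck FiFk).
have -> : \bigcup_(i in C) F i = \bigcup_(n in f @` C) B n.
  by rewrite bigcup_image; apply: eq_bigcupr => i Ci; rewrite BfE.
rewrite measure_bigcup// nneseries_esum// set_mem_set esum_image//.
by apply: eq_esum => i Ci; rewrite BfE.
Qed.

End countable_additivity.

Section discrete_laws.
Context (R : realType) (dT : measure_display) (T : measurableType dT).
Context (P : probability T R) (G : zmodType).
Local Open Scope ereal_scope.

(** Phrased through fibres, since [G] carries no sigma-algebra here; atoms of total mass 1 determine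
    the whole law. *)
Definition discrete_map (Z : T -> G) : Prop :=
  (forall x, measurable (Z @^-1` [set x])) /\
  \esum_(x in setT) P (Z @^-1` [set x]) = 1.

Lemma trivIset_atoms (Z : T -> G) (A : set T) (D : set G) :
  trivIset D (fun x => A `&` Z @^-1` [set x]).
Proof. by move=> x y _ _ [w [[_ Zx] [_ Zy]]]; exact: etrans (esym Zx) Zy. Qed.

(** Each finite partial sum is the measure of a disjoint union inside [A]. *)
Lemma esum_atoms_le (Z : T -> G) (A : set T) :
  (forall x, measurable (Z @^-1` [set x])) -> measurable A ->
  \esum_(x in setT) P (A `&` Z @^-1` [set x]) <= P A.
Proof.
move=> mZ mA; apply: ge_ereal_sup => _ [X [finX _] <-].
have mAZ x : measurable (A `&` Z @^-1` [set x]) by exact: measurableI.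
rewrite -measure_fin_bigcup//; last exact: trivIset_atoms.
rewrite le_measure ?inE//; first exact: fin_bigcup_measurable.
by move=> w [x _ []].
Qed.

(* Both [P A] and [P (~` A)] dominate the corresponding sums, which add up
   to 1, so that no countable support is needed. *)
Lemma total_probability (Z : T -> G) (A : set T) :
  discrete_map Z -> measurable A ->
  P A = \esum_(x in setT) P (A `&` Z @^-1` [set x]).
Proof.
move=> [mZ Z1] mA; apply/eqP; rewrite eq_le esum_atoms_le// andbT.
have mCA := measurableC mA.
have : \esum_(x in setT) P (A `&` Z @^-1` [set x]) +
       \esum_(x in setT) P (~` A `&` Z @^-1` [set x]) = 1.
  rewrite -Z1 -esumD//; apply: eq_esum => x _.
  rewrite -measureU; [|exact: measurableI|exact: measurableI|].
    by rewrite -setIUl setUv setTI.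
  by apply/seteqP; split=> // w [[? _] [? _]].
have := esum_atoms_le mZ mCA; rewrite probability_setC//.
have := esum_atoms_le mZ mA; have := fin_num_measure P A mA.
have : 0 <= \esum_(x in setT) P (A `&` Z @^-1` [set x]) by exact: esum_ge0.
case: (P A) => // a; case: (esum _ _) => [s| |]//; case: (esum _ _) => [t| |]//.
rewrite -EFinB -EFinD !lee_fin => _ _ _ ta [st].
by lra.
Qed.

(** Countable additivity over [C] gives total atomic mass at least 1, and [esum_atoms_le] bounds it
    by 1. *)
Lemma countable_discrete_map (Z : T -> G) (C : set G) :
  (forall x, measurable (Z @^-1` [set x])) ->
  countable C -> P (Z @^-1` C) = 1 -> discrete_map Z.
Proof.
move=> mZ C_count ZC1; split=> //; apply/eqP; rewrite eq_le; apply/andP; split.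
  rewrite -(probability_setT P) (le_trans _ (esum_atoms_le mZ measurableT))//.
  by apply: le_esum => x _; rewrite setTI.
have ZC : Z @^-1` C = \bigcup_(x in C) (setT `&` Z @^-1` [set x]).
  by apply/seteqP; split=> [w Cw|w [x Cx [_ /= ->]]]//; exists (Z w).
have := @measure_countable_bigcup _ _ _ P _ C
    (fun x => setT `&` Z @^-1` [set x]) C_count.
rewrite -ZC ZC1 => ->; last 2 first.
- by move=> x _; rewrite setTI.
- exact: trivIset_atoms.
rewrite esum_mkcond; apply: le_esum => x _.
by rewrite setTI; case: ifP.
Qed.

Definition law (Z : T -> G) (dZ : discrete_map Z) : pmf R G :=
  Pmf (fun x => measure_ge0 P (Z @^-1` [set x])) dZ.2.

Definition atom_independent (I : finType) (Z : I -> T -> G) : Prop :=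
  forall (J : {set I}) (y : I -> G),
    P (\bigcap_(i in [set` J]) Z i @^-1` [set y i]) =
    \prod_(i in J) P (Z i @^-1` [set y i]).

Section sum_of_independent.
Variables (I : finType) (Z : I -> T -> G).
Hypothesis dZ : forall i, discrete_map (Z i).
Hypothesis indepZ : atom_independent Z.
Hypothesis m_sum : forall (s : seq I) x,
  measurable [set w | (\sum_(i <- s) Z i w)%R = x].

Let p i := law (dZ i).

Lemma law_sum_indep (s : seq I) (J : {set I}) (y : I -> G) x :
  uniq s -> all [predC J] s ->
  P ((\bigcap_(i in [set` J]) Z i @^-1` [set y i]) `&`
     [set w | (\sum_(i <- s) Z i w)%R = x]) =
  (\prod_(i in J) P (Z i @^-1` [set y i])) * conv_seq p s x.
Proof.
have mE (K : {set I}) z :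
    measurable (\bigcap_(i in [set` K]) Z i @^-1` [set z i]).
  apply: fin_bigcap_measurable => [|i _]; first exact: finite_finset.
  by have [] := dZ i.
elim: s J y x => [|i s IH] J y x.
  move=> _ _; rewrite /conv_seq big_nil /= /dirac_fun.
  have [->|x0] := eqVneq x 0%R.
    rewrite mule1 -indepZ; congr (P _); apply/seteqP; split=> [w []//|w Ew].
    by split=> //=; rewrite big_nil.
  rewrite mule0 -(measure0 P); congr (P _); apply/seteqP; split=> // w [_ /=].
  by rewrite big_nil => x0'; rewrite x0' eqxx in x0.
move=> /=/andP[i_s uniq_s]; move=> /andP[iJ sJ].
rewrite (total_probability (dZ i)); last exact: measurableI.
rewrite conv_seq_cons convE -esumZl; last 3 first.
- by apply: prode_ge0.
(* By independence the constant factor is itself a probability, hence finite. *)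
- rewrite -indepZ fin_num_measure//.
- by move=> z; rewrite mule_ge0 ?pmf_ge0.
apply: eq_esum => z _.
pose y' k := if k == i then z else y k.
transitivity (P ((\bigcap_(k in [set` i |: J]) Z k @^-1` [set y' k]) `&`
     [set w | (\sum_(k <- s) Z k w)%R = (x - z)%R])).
  congr (P _); apply/seteqP; split=> w /=.
    move=> [[Ew]]; rewrite big_cons => <- Zz.
    split; last by rewrite Zz addrC addKr.
    move=> k /=; rewrite /y' in_setU1 => /orP[/eqP ->|kJ].
      by rewrite eqxx.
    by case: eqP => [->//|_]; exact: Ew.
  move=> [Ew Sw]; have Zz : Z i w = z.
    by have /= := Ew i; rewrite /y' setU11 eqxx; exact.
  split=> //; split; last by rewrite big_cons Zz Sw addrC subrK.
  move=> k /= kJ; have /= := Ew k; rewrite /y' in_setU1 kJ orbT.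
  by case: eqP => [ki|_]; [rewrite ki (negPf iJ) in kJ|exact].
rewrite IH//; last first.
  apply/allP => k ks; rewrite /= in_setU1 negb_or.
  apply/andP; split; last exact: (allP sJ).
  by apply: contraNneq i_s => <-.
rewrite big_setU1//= /y' eqxx muleA; congr (_ * _).
rewrite muleC; congr (_ * _).
by apply: eq_bigr => k kJ; case: eqP => // ki; rewrite ki (negPf iJ) in kJ.
Qed.

Lemma law_sum (s : seq I) x : uniq s ->
  P [set w | (\sum_(i <- s) Z i w)%R = x] = conv_seq p s x.
Proof.
move=> uniq_s; have := @law_sum_indep s (@finset.set0 I) (fun=> 0%R) x uniq_s.
rewrite big_set0 mul1e => <-; last by apply/allP => k _; rewrite /= inE.
congr (P _); apply/seteqP; split=> [w ?|w []]//.
by split=> // k /=; rewrite inE.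
Qed.

End sum_of_independent.
End discrete_laws.

(** By total probability only the atoms matter, and each atom is either contained in the preimage of
    [A] or disjoint from it. *)
Lemma same_atoms_distribution (R : realType) (d1 d2 : measure_display)
    (T1 : measurableType d1) (T2 : measurableType d2)
    (P1 : probability T1 R) (P2 : probability T2 R) (G : zmodType)
    (Z1 : T1 -> G) (Z2 : T2 -> G) (A : set G) :
  discrete_map P1 Z1 -> discrete_map P2 Z2 ->
  (forall x, P1 (Z1 @^-1` [set x]) = P2 (Z2 @^-1` [set x])) ->
  measurable (Z1 @^-1` A) -> measurable (Z2 @^-1` A) ->
  P1 (Z1 @^-1` A) = P2 (Z2 @^-1` A).
Proof.
move=> dZ1 dZ2 Z12 mA1 mA2.
rewrite (total_probability dZ1 mA1) (total_probability dZ2 mA2).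
apply: eq_esum => x _; have [xA|xA] := pselect (A x).
  have aux (T : Type) (Z : T -> G) :
      Z @^-1` A `&` Z @^-1` [set x] = Z @^-1` [set x].
    by apply/seteqP; split=> [w []//|w /= Zw]; split=> //=; rewrite Zw.
  by rewrite !aux.
have aux (T : Type) (Z : T -> G) : Z @^-1` A `&` Z @^-1` [set x] = set0.
  by apply/seteqP; split=> // w [/= ZwA Zw]; apply: xA; rewrite -Zw.
by rewrite !aux !measure0.
Qed.

(** * Borel measurability of vector operations *)

Section measurable_row_vectors.
Context (R : realType) (d : nat) (dT : measure_display) (T : measurableType dT).
Implicit Types f g : T -> 'rV[R]_d.

Lemma rV_rat_dense (x : 'rV[R]_d) (e : R) : 0 < e ->
  exists q : 'rV[rat]_d, ball x e (map_mx ratr q).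
Proof.
move=> e_gt0.
have /choice[q qP] (j : 'I_d) : exists q : rat, ball (x ord0 j) e (ratr q).
  have [|q] := @rat_in_itvoo _ (x ord0 j - e) (x ord0 j + e); first by lra.
  rewrite in_itv/= => /andP[q1 q2]; exists q.
  by rewrite /ball/= ltr_norml; apply/andP; split; lra.
exists (\row_j q j); split=> // i j; rewrite !mxE ord1; exact: qP.
Qed.

Lemma measurable_rV_open f :
  (forall U : set 'rV[R]_d, open U -> measurable (f @^-1` U)) ->
  measurable_fun setT f.
Proof.
move=> mf; apply: (measurability (@open 'rV[R]_d)) => //.
by move=> _ [U openU <-]; rewrite setTI; exact: mf.
Qed.

Lemma open_measurable_rV (U : set 'rV[R]_d) : open U -> measurable U.
Proof. by move=> openU; exact: sub_sigma_algebra. Qed.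

Lemma measurable_set1_rV (x : 'rV[R]_d) : measurable [set x].
Proof.
rewrite -(setCK [set x]); apply: measurableC; apply: open_measurable_rV.
rewrite openC; apply: accessible_closed_set1; apply: hausdorff_accessible.
exact: norm_hausdorff.
Qed.

(** The preimage of an open [U] is a union over the countably many pairs of balls with rational
    centres and common radius [1/(k+1)] whose sumset lies in [U]. *)
Lemma measurable_rV_add f g : measurable_fun setT f -> measurable_fun setT g ->
  measurable_fun setT (fun w => f w + g w).
Proof.
move=> mf mg; apply: measurable_rV_open => U openU.
pose B (q : 'rV[rat]_d) (k : nat) : set 'rV[R]_d :=
  ball (map_mx ratr q : 'rV[R]_d) k.+1%:R^-1.
pose D (t : 'rV[rat]_d * 'rV[rat]_d * nat) :=
  forall a b, B t.1.1 t.2 a -> B t.1.2 t.2 b -> U (a + b).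
have -> : (fun w => f w + g w) @^-1` U =
    \bigcup_(t in D) (f @^-1` B t.1.1 t.2 `&` g @^-1` B t.1.2 t.2).
  apply/seteqP; split=> [w /= Uw|w [t Dt [ft gt]]]; last exact: Dt.
  have /nbhs_ballP[e /= e_gt0 eU] : nbhs (f w + g w) U by exact: open_nbhs_nbhs.
  (* [f w] and [a] are within one radius of the first centre, [g w] and [b] of the second, so
     [f w + g w] and [a + b] differ by less than four radii; hence [e / 4]. *)
  have [k ke] : exists k, k.+1%:R^-1 < e / 4%:R.
    have e4 : 0 < e / 4%:R by rewrite divr_gt0.
    have [k _ kP] := near_infty_natSinv_lt (PosNum e4).
    by exists k; exact: (kP k (leqnn k)).
  have k_gt0 : 0 < k.+1%:R^-1 :> R by rewrite invr_gt0.
  have [q1 q1P] := rV_rat_dense (f w) k_gt0.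
  have [q2 q2P] := rV_rat_dense (g w) k_gt0.
  exists ((q1, q2), k); last by split; apply: ball_sym.
  move=> a b /= q1a q2b; apply: eU.
  have fa := ball_triangle q1P q1a; have gb := ball_triangle q2P q2b.
  move: fa gb; rewrite -!ball_normE /= => fa gb.
  rewrite opprD addrACA (le_lt_trans (ler_normD _ _))//.
  by apply: lt_trans (ltrD fa gb) _; move: ke; set r := _^-1 => ?; lra.
have mB (h : T -> 'rV[R]_d) q k : measurable_fun setT h ->
    measurable (h @^-1` B q k).
  move=> mh; rewrite -(setTI (_ @^-1` _)); apply: mh => //.
  by apply: open_measurable_rV; exact: ball_open.
rewrite bigcup_mkcond; apply: countable_bigcupT_measurable => // t.
by case: ifP => // _; apply: measurableI; exact: mB.
Qed.

Lemma measurable_rV_sum (I : Type) (s : seq I) (F : I -> T -> 'rV[R]_d) :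
  (forall i, measurable_fun setT (F i)) ->
  measurable_fun setT (fun w => \sum_(i <- s) F i w).
Proof.
move=> mF; elim: s => [|i s IH].
  under eq_fun do rewrite big_nil; exact: measurable_cst.
by under eq_fun do rewrite big_cons; exact: measurable_rV_add.
Qed.

Lemma measurable_rV_scale (c : R) f :
  measurable_fun setT f -> measurable_fun setT (fun w => c *: f w).
Proof.
move=> mf; apply: measurable_rV_open => U openU.
rewrite -(setTI (_ @^-1` _)).
apply: (mf measurableT ((fun v => c *: v) @^-1` U)).
apply: open_measurable_rV; apply: open_comp => // v _.
exact: scaler_continuous.
Qed.

End measurable_row_vectors.

(** Positions [2k] and [2k+1] contribute [p j] and its mirror, that is one factor [symm (p j)], and
    [symm] is multiplicative. *)
Lemma conv_alternating (R : realType) (G : zmodType) (I : finType)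
    (p : I -> pmf R G) (j : I) (m : nat) :
  \big[@conv R G/dirac_pmf R 0]_(i < m.*2)
     (if odd i then mirror (p j) else p j) = symm (conv_seq p (nseq m j)).
Proof.
elim: m => [|m IH].
  by rewrite big_ord0 /conv_seq big_nil symm_dirac.
rewrite doubleS !big_ord_recr /= IH conv_seq_cons symm_conv odd_double /=.
by rewrite -convA convC.
Qed.

(** * Discrete random vectors and the inequality *)

Section discrete_random_vectors.
Context (R : realType) (d : nat) (dT : measure_display) (T : measurableType dT).
Context (P : probability T R).

(** Points are Borel, hence so is the countable support, and its preimage has negligible
    complement. *)
Lemma discrete_rv_map (X : {RV P >-> 'rV[R]_d}) :
  discrete_rv X -> discrete_map P X.
Proof.
move=> [C C_count XC].
have mC : measurable C.
  by apply: countable_measurable => // x; exact: measurable_set1_rV.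
apply: (countable_discrete_map _ C_count) => [x|].
  by apply: measurable_funPTI; exact: measurable_set1_rV.
have mXC : measurable (X @^-1` C) by exact: measurable_funPTI.
rewrite -(setCK (X @^-1` C)) probability_setC; last exact: measurableC.
suff -> : P (~` (X @^-1` C)) = 0 by rewrite sube0.
by apply/negligibleP; [exact: measurableC|exact: XC].
Qed.

Lemma mutually_independent_atoms (I : finType)
    (X : I -> {RV P >-> 'rV[R]_d}) :
  mutually_independent X -> atom_independent P X.
Proof. by move=> indepX J y; apply: indepX => i; exact: measurable_set1_rV. Qed.

Lemma measurable_sum_atom (I : Type) (s : seq I) (Z : I -> T -> 'rV[R]_d) x :
  (forall i, measurable_fun setT (Z i)) ->
  measurable [set w | \sum_(i <- s) Z i w = x].
Proof.
move=> mZ; have := measurable_rV_sum s mZ measurableT (measurable_set1_rV x).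
by rewrite setTI.
Qed.

End discrete_random_vectors.

Theorem lemma1 (R : realType) (d n : nat) (n_gt0 : (0 < n)%N)
    (n_even : ~~ odd n) (dT : measure_display) (T : measurableType dT)
    (P : probability T R) (X : 'I_n -> {RV P >-> 'rV[R]_d})
    (X_discrete : forall i, discrete_rv (X i))
    (X_indep : mutually_independent X) :
  exists j : 'I_n, forall x : 'rV[R]_d,
    forall (dT' : measure_display) (T' : measurableType dT')
           (P' : probability T' R) (Y : 'I_n -> {RV P' >-> 'rV[R]_d}),
      iid_copies Y (X j) ->
      (P [set w | (\sum_(i < n) X i w)%R = x] <=
         P' [set w | alternating_sum Y w = 0%R])%E /\
      (~ same_distribution P P' (fun w => (\sum_(i < n) X i w) - x)
           (alternating_sum Y) ->
       (P [set w | (\sum_(i < n) X i w)%R = x] <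
         P' [set w | alternating_sum Y w = 0%R])%E).
Proof.
have dX i : discrete_map P (X i) by exact: discrete_rv_map.
pose p i := law (dX i); pose m := n./2.
have nE : n = m.*2 by rewrite even_halfK.
have m_gt0 : (0 < m)%N by rewrite -double_gt0 -nE.
have [j jP] := exists_maximal_power p (Ordinal n_gt0) m_gt0.
(* [V] is the law of the alternating sum, as [AE] shows below. *)
pose V := symm (conv_seq p (nseq m j)).
exists j => x dT' T' P' Y [Y_indep Y_law].
have mX i : measurable_fun setT (X i) by exact: measurable_funP.
have SE v : P [set w | \sum_(i < n) X i w = v] = conv_seq p (enum 'I_n) v.
  rewrite -(law_sum _ (mutually_independent_atoms X_indep)) ?enum_uniq//.
    by congr (P _); apply/seteqP; split=> w /=; rewrite big_enum.
  by move=> s v'; exact: measurable_sum_atom.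
pose Z (i : 'I_n) w := (-1) ^+ i *: Y i w.
have mZ i : measurable_fun setT (Z i).
  by apply: measurable_rV_scale; exact: measurable_funP.
(* A sign is its own inverse, so the fibres of a signed copy are fibres of [Y i]; odd indices thus
   get the mirrored law. *)
have ZE i v : Z i @^-1` [set v] = Y i @^-1` [set (-1) ^+ i *: v].
  by apply/seteqP; split=> [w /= <-|w /= Yw]; rewrite /Z ?Yw
    scalerA -expr2 sqrr_sign scale1r.
have Z_law i v : P' (Z i @^-1` [set v]) =
    (if odd i then mirror (p j) else p j) v.
  rewrite ZE; apply: (etrans (Y_law i _ (measurable_set1_rV _))).
  by rewrite -signr_odd; case: (odd i); rewrite (scaleN1r, scale1r).
have mZ1 i v : measurable (Z i @^-1` [set v]).
  by rewrite -(setTI (_ @^-1` _)); apply: mZ => //; exact: measurable_set1_rV.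
have dZ i : discrete_map P' (Z i).
  split=> //; rewrite -[RHS](pmf_sum1 (if odd i then mirror (p j) else p j)).
  by apply: eq_esum => v _; rewrite Z_law.
have Z_indep : atom_independent P' Z.
  move=> J y; have := mutually_independent_atoms Y_indep J
    (fun i => (-1) ^+ i *: y i).
  rewrite (eq_bigr (fun i => P' (Z i @^-1` [set y i]))); last first.
    by move=> i _; rewrite ZE.
  by move=> <-; congr (P' _); apply: eq_bigcapr => i _; rewrite ZE.
have lawZ i : law (dZ i) = if odd i then mirror (p j) else p j.
  by apply: pmf_ext => v; exact: Z_law.
have AE v : P' [set w | alternating_sum Y w = v] = V v.
  have -> : [set w | alternating_sum Y w = v] =
      [set w | \sum_(i <- enum 'I_n) Z i w = v].
    by apply/seteqP; split=> w /=; rewrite big_enum.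
  rewrite (law_sum dZ Z_indep) ?enum_uniq//; last first.
    by move=> s v'; exact: measurable_sum_atom.
  rewrite /conv_seq (eq_bigr (fun i : 'I_n =>
    if odd i then mirror (p j) else p j)) => [|i _]; last exact: lawZ.
  by rewrite /V -conv_alternating big_enum /= nE.
(* The two halves of the sum; together they enumerate all indices, so [j] occurs in one of them. *)
pose s := take m (enum 'I_n); pose t := drop m (enum 'I_n).
have stE : s ++ t = enum 'I_n by rewrite cat_take_drop.
have [|||le_V eq_V] := jP s t x.
- by rewrite size_takel// size_enum_ord nE -addnn leq_addr.
- by rewrite size_drop size_enum_ord nE -addnn addnK.
- by rewrite stE mem_enum.
rewrite SE AE -stE conv_seq_cat; split=> // not_same.
(* Contrapositive: equality at [x] gives the sum of the [X i], shifted by [-x], the law [V] of the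
   alternating sum. *)
rewrite lt_neqAle le_V andbT; apply/eqP => /eq_V stV; apply: not_same => A mA.
pose S' w := \sum_(i < n) X i w - x.
have mS' : measurable_fun setT S'.
  apply: (@measurable_rV_add _ _ _ _ _ (fun=> - x)).
    exact: measurable_rV_sum.
  exact: measurable_cst.
have malt : measurable_fun setT (alternating_sum Y) by exact: measurable_rV_sum.
have preimage_m d' (T'' : measurableType d') (f : T'' -> 'rV[R]_d) B :
    measurable_fun setT f -> measurable B -> measurable (f @^-1` B).
  by move=> mf mB; rewrite -(setTI (_ @^-1` _)); exact: mf.
have S'E v : P (S' @^-1` [set v]) = V v.
  rewrite /V -stV conv_diracE opprK -conv_seq_cat stE -SE.
  congr (P _); apply/seteqP; split=> w /=; first by move=> <-; rewrite subrK.
  by rewrite /S' => ->; rewrite addrK.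
have discrete d' (T'' : measurableType d') (Q : probability T'' R) f :
    measurable_fun setT f -> (forall v, Q (f @^-1` [set v]) = V v) ->
    discrete_map Q f.
  move=> mf fV; split=> [v|]; first exact: preimage_m (measurable_set1_rV v).
  by rewrite -[RHS](pmf_sum1 V); apply: eq_esum => v _; exact: fV.
apply: same_atoms_distribution; rewrite -/S'.
- exact: discrete.
- exact: discrete.
- by move=> v; rewrite S'E; exact/esym/AE.
- exact: preimage_m.
- exact: preimage_m.
Qed.
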